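(* Let $\Delta t>0$, let $k,r\ge0$ be integers, and let $(f_h^n,\mathbf{E}_h^n,\mathbf{B}_h^n)\mapsto(f_h^{n+1},\mathbf{E}_h^{n+1},\mathbf{B}_h^{n+1})$ be one step of any of the fully discrete discontinuous Galerkin methods with time integrator Scheme-1$(\Delta t)$, Scheme-2$(\Delta t)$, Scheme-3$(\Delta t)$, Scheme-4$(\Delta t)$, Scheme-3F$(\Delta t)$ or Scheme-4F$(\Delta t)$ described in the context. Then the total particle number is preserved: $$\int_{\Omega_x}\int_{\Omega_v} f_h^{n+1}\,d\mathbf{v}\,d\mathbf{x}=\int_{\Omega_x}\int_{\Omega_v} f_h^{n}\,d\mathbf{v}\,d\mathbf{x}.$$
   Context: Mesh and spaces. $\Omega_x\subset\mathbb{R}^3$ is a box with periodic boundary conditions, $\Omega_v\subset\mathbb{R}^3$ a bounded velocity domain. $\mathcal{T}_h^x=\{K_x\}$ and $\mathcal{T}_h^v=\{K_v\}$ are partitions of $\Omega_x$ (periodic) and $\Omega_v$ into (rotated) Cartesian elements or simplices; $\mathcal{T}_h=\{K=K_x\times K_v\}$. $\mathcal{G}_h^k=\{g\in L^2(\Omega_x\times\Omega_v): g|_{K}\in P^k(K)\ \forall K\in\mathcal{T}_h\}$ and $\mathcal{U}_h^r=\{\mathbf{U}\in[L^2(\Omega_x)]^3:\mathbf{U}|_{K_x}\in[P^r(K_x)]^3\ \forall K_x\in\mathcal{T}_h^x\}$, where $P^k(D)$ is the set of polynomials of total degree at most $k$ on $D$. On each interior edge (face) $e=K^+\cap K^-$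 of $\mathcal{T}_h^x$ (periodically identified) or $\mathcal{T}_h^v$, with a fixed labelling of the two neighbours as $\pm$ and outward unit normals $\mathbf{n}^\pm$ of $K^\pm$: jumps $[g]=g^+\mathbf{n}^++g^-\mathbf{n}^-$, averages $\{g\}=\frac12(g^++g^-)$, $\{\mathbf{U}\}=\frac12(\mathbf{U}^++\mathbf{U}^-)$, with subscript $x$ or $v$ indicating the variable in which the traces are taken. $\mathbf{n}_x$, $\mathbf{n}_v$ are outward unit normals of $\partial K_x$, $\partial K_v$. Velocity boundary: standing assumption that $\Omega_v$ is so large that all numerical $f_h$'s (including intermediate ones) vanish on $\partial\Omega_v$, and the numerical flux in $\mathbf{v}$ on faces contained in $\partial\Omega_v$ is zero. Forms. For $f,\psi\in\mathcal{G}_h^k$ and fields $\mathbf{E},\mathbf{B}\in\mathcal{U}_h^r$, with $\mathbf{F}=\mathbf{E}+\mathbf{v}\times\mathbf{B}$, $A_K(f;\mathbf{E},\mathbf{B};\psi)=-\int_K f\mathbf{v}\cdot\nabla_{\mathbf{x}}\psi\,d\mathbf{v}d\mathbf{x}-\int_K f\,\mathbf{F}\cdot\nabla_{\mathbf{v}}\psi\,d\mathbf{v}d\mathbf{x}+\int_{K_v}\int_{\partial K_x}\widehat{f\mathbf{v}\cdot\mathbf{n}_x}\,\psi\,ds_xd\mathbf{v}+\int_{K_x}\int_{\partial K_v}\widehat{f\mathbf{F}\cdot\mathbf{n}_v}\,\psi\,ds_vd\mathbf{x}$ (traces of $\psi$ from inside $K$). Vlasov fluxes: central: $\widehat{f\mathbf{v}\cdot\mathbf{n}_x}=\{f\mathbf{v}\}_x\cdot\mathbf{n}_x$,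 $\widehat{f\mathbf{F}\cdot\mathbf{n}_v}=\{f\mathbf{F}\}_v\cdot\mathbf{n}_v$; or upwind: $\widehat{f\mathbf{v}\cdot\mathbf{n}_x}=(\{f\mathbf{v}\}_x+\frac{|\mathbf{v}\cdot\mathbf{n}_x|}{2}[f]_x)\cdot\mathbf{n}_x$, $\widehat{f\mathbf{F}\cdot\mathbf{n}_v}=(\{f\mathbf{F}\}_v+\frac{|\mathbf{F}\cdot\mathbf{n}_v|}{2}[f]_v)\cdot\mathbf{n}_v$. In a (sub)step with negative step size the upwind flux is replaced by the downwind flux, i.e. the sign in front of the jump terms is changed from $+$ to $-$. $C^E_{K_x}(\mathbf{E};\mathbf{U})=\int_{K_x}\mathbf{E}\cdot\nabla_{\mathbf{x}}\times\mathbf{U}\,d\mathbf{x}+\int_{\partial K_x}(\mathbf{n}_x\times\widetilde{\mathbf{E}})\cdot\mathbf{U}\,ds_x$, $C^B_{K_x}(\mathbf{B};\mathbf{V})=\int_{K_x}\mathbf{B}\cdot\nabla_{\mathbf{x}}\times\mathbf{V}\,d\mathbf{x}+\int_{\partial K_x}(\mathbf{n}_x\times\widetilde{\mathbf{B}})\cdot\mathbf{V}\,ds_x$, with Maxwell fluxes chosen (once and for all) as central: $\widetilde{\mathbf{E}}=\{\mathbf{E}\}_x,\ \widetilde{\mathbf{B}}=\{\mathbf{B}\}_x$; or alternating: $\widetilde{\mathbf{E}}=\mathbf{E}^+,\ \widetilde{\mathbf{B}}=\mathbf{B}^-$; or alternating: $\widetilde{\mathbf{E}}=\mathbf{E}^-,\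 \widetilde{\mathbf{B}}=\mathbf{B}^+$. $\mathbf{J}_h^s(\mathbf{x})=\int_{\Omega_v}f_h^s\,\mathbf{v}\,d\mathbf{v}$. Fully discrete schemes with step $\tau$ (all $f_h$'s in $\mathcal{G}_h^k$, all $\mathbf{E}_h,\mathbf{B}_h$'s in $\mathcal{U}_h^r$; the equations hold for all elements and all test functions $\psi\in\mathcal{G}_h^k$, $\mathbf{U},\mathbf{V}\in\mathcal{U}_h^r$; for implicit schemes the new state is any solution). Write $\bar g=\frac12(g^n+g^{n+1})$. Scheme-1$(\tau)$: $\int_K\frac{f_h^{n+1/2}-f_h^n}{\tau/2}\psi+A_K(f_h^n;\mathbf{E}_h^n,\mathbf{B}_h^n;\psi)=0$; $\int_{K_x}\frac{\mathbf{B}_h^{n+1/2}-\mathbf{B}_h^n}{\tau/2}\cdot\mathbf{U}=-C^E_{K_x}(\mathbf{E}_h^n;\mathbf{U})$; $\int_{K_x}\frac{\mathbf{E}_h^{n+1}-\mathbf{E}_h^n}{\tau}\cdot\mathbf{V}=C^B_{K_x}(\mathbf{B}_h^{n+1/2};\mathbf{V})-\int_{K_x}\mathbf{J}_h^{n+1/2}\cdot\mathbf{V}$; $\int_{K_x}\frac{\mathbf{B}_h^{n+1}-\mathbf{B}_h^{n+1/2}}{\tau/2}\cdot\mathbf{U}=-C^E_{K_x}(\mathbf{E}_h^{n+1};\mathbf{U})$; $\int_K\frac{f_h^{n+1}-f_h^n}{\tau}\psi+A_K(f_h^{n+1/2};\bar{\mathbf{E}}_h,\mathbf{B}_h^{n+1/2};\psi)=0$.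 Scheme-2$(\tau)$: $\int_K\frac{f_h^{n+1/2}-f_h^n}{\tau/2}\psi+A_K(f_h^n;\mathbf{E}_h^n,\mathbf{B}_h^n;\psi)=0$; $\int_{K_x}\frac{\mathbf{B}_h^{n+1}-\mathbf{B}_h^n}{\tau}\cdot\mathbf{U}=-C^E_{K_x}(\bar{\mathbf{E}}_h;\mathbf{U})$; $\int_{K_x}\frac{\mathbf{E}_h^{n+1}-\mathbf{E}_h^n}{\tau}\cdot\mathbf{V}=C^B_{K_x}(\bar{\mathbf{B}}_h;\mathbf{V})-\int_{K_x}\mathbf{J}_h^{n+1/2}\cdot\mathbf{V}$; $\int_K\frac{f_h^{n+1}-f_h^n}{\tau}\psi+A_K(f_h^{n+1/2};\bar{\mathbf{E}}_h,\bar{\mathbf{B}}_h;\psi)=0$. Scheme-3$(\tau)$: $\int_{K_x}\frac{\mathbf{E}_h^{n+1/2}-\mathbf{E}_h^n}{\tau/2}\cdot\mathbf{V}=C^B_{K_x}(\mathbf{B}_h^n;\mathbf{V})-\int_{K_x}\mathbf{J}_h^n\cdot\mathbf{V}$; $\int_{K_x}\frac{\mathbf{B}_h^{n+1}-\mathbf{B}_h^n}{\tau}\cdot\mathbf{U}=-C^E_{K_x}(\mathbf{E}_h^{n+1/2};\mathbf{U})$; $\int_K\frac{f_h^{n+1}-f_h^n}{\tau}\psi+A_K(\bar f_h;\mathbf{E}_h^{n+1/2},\bar{\mathbf{B}}_h;\psi)=0$; $\int_{K_x}\frac{\mathbf{E}_h^{n+1}-\mathbf{E}_h^{n+1/2}}{\tau/2}\cdot\mathbf{V}=C^B_{K_x}(\mathbf{B}_h^{n+1};\mathbf{V})-\int_{K_x}\mathbf{J}_h^{n+1}\cdot\mathbf{V}$.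 Scheme-4$(\tau)$: $\int_{K_x}\frac{\mathbf{B}_h^{n+1}-\mathbf{B}_h^n}{\tau}\cdot\mathbf{U}=-C^E_{K_x}(\bar{\mathbf{E}}_h;\mathbf{U})$; $\int_{K_x}\frac{\mathbf{E}_h^{n+1}-\mathbf{E}_h^n}{\tau}\cdot\mathbf{V}=C^B_{K_x}(\bar{\mathbf{B}}_h;\mathbf{V})-\int_{K_x}\bar{\mathbf{J}}_h\cdot\mathbf{V}$; $\int_K\frac{f_h^{n+1}-f_h^n}{\tau}\psi+A_K(\bar f_h;\bar{\mathbf{E}}_h,\bar{\mathbf{B}}_h;\psi)=0$. Scheme-3F$(\tau)$ and Scheme-4F$(\tau)$: the compositions Scheme-$j(\beta_1\tau)$ Scheme-$j(\beta_2\tau)$ Scheme-$j(\beta_3\tau)$, $j=3,4$ respectively, with $\beta_1=\beta_3=(2+2^{1/3}+2^{-1/3})/3$, $\beta_2=1-2\beta_1<0$ (downwind flux instead of upwind in the $\beta_2$ substep). *)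

(* Defs.v *)
From mathcomp Require Import all_boot all_order all_algebra.
From mathcomp Require Import all_classical all_reals all_analysis.
(* The notations of mpoly clash with those of mathcomp-analysis. *)
From mathcomp.multinomials Require mpoly.
Import -(notations) mpoly.

Set Implicit Arguments.
Unset Strict Implicit.
Unset Printing Implicit Defensive.
Import Order.TTheory GRing.Theory Num.Theory.
Import numFieldNormedType.Exports.

Local Open Scope classical_set_scope.
Local Open Scope ring_scope.

Section Euclidean.
Variable R : realType.
Local Notation vec := 'rV[R]_3.

Definition dot (u w : vec) : R := \sum_(i < 3) u 0 i * w 0 i.

(* Indices are added modulo 3. *)
Definition cross (u w : vec) : vec :=
  \row_(i < 3) (u 0 (i + 1) * w 0 (i + 2) - u 0 (i + 2) * w 0 (i + 1)).

Definition vec3 (p : R * R * R) : vec := \row_(i < 3) [:: p.1.1; p.1.2; p.2]`_i.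

Definition vint (A : set vec) (g : vec -> R) : R :=
  \int[((@lebesgue_measure R \x @lebesgue_measure R)
            \x @lebesgue_measure R)%E]_(p in vec3 @^-1` A) g (vec3 p).

(* A has affine dimension at least 2. *)
Definition two_dim (A : set vec) : Prop :=
  exists p q r, [/\ A p, A q, A r & cross (q - p) (r - p) != 0].

Definition translate (s : vec) (A : set vec) : set vec := [set x | A (x - s)].

Definition boundary (A : set vec) : set vec := closure A `\` interior A.

End Euclidean.

Section Meshes.
Variable R : realType.
Local Notation vec := 'rV[R]_3.

Definition is_simplex (K : set vec) : Prop :=
  exists (p : vec) (M : 'M[R]_3), M \in unitmx /\
    K = [set p + t *m M | t in
          [set t : vec | (forall i, 0 <= t 0 i) /\ \sum_i t 0 i <= 1]].

(* The rows of M are the edge vectors. *)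
Definition is_rotated_box (K : set vec) : Prop :=
  exists (p : vec) (M : 'M[R]_3), [/\ M \in unitmx, is_diag_mx (M *m M^T) &
    K = [set p + t *m M | t in
          [set t : vec | forall i, 0 <= t 0 i <= 1]]].

(* A partition of the closed region Omega into closed elements, whose points
   are identified modulo the group of translations Lambda ([set 0] when there
   is no identification).  An interior edge (face) e is
   K^+ `&` translate s K^-, where s in Lambda is the translation through which
   the two elements are neighbours.  Conversely every two-dimensional
   intersection of an element with a translate of an element is exactly one of
   the edges, in one of the two possible labellings; hanging nodes are allowed,
   and K^+ = K^- may occur when s <> 0.

   The plane of e is given by a point [eorig e] and an orthonormal frame whose
   rows are two tangent vectors and the unit normal n^+; the data of the frame
   only serve to parametrize e isometrically. *)
Record mesh (Omega Lambda : set vec) := Mesh {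
  elt : finType;
  eset : elt -> set vec;
  eset_shape : forall K, is_simplex (eset K) \/ is_rotated_box (eset K);
  eset_cover : \bigcup_(K in [set: elt]) eset K = Omega;
  eset_disjoint : forall K K', K != K' ->
    interior (eset K) `&` interior (eset K') = set0;
  edge : finType;
  eplus : edge -> elt;
  eminus : edge -> elt;
  eshift : edge -> vec;
  eshift_in : forall e, Lambda (eshift e);
  edge_set := fun e : edge =>
    eset (eplus e) `&` translate (eshift e) (eset (eminus e));
  edge_two_dim : forall e, two_dim (edge_set e);
  edge_complete : forall (K K' : elt) (s : vec), Lambda s ->
    (K, s) <> (K', 0) -> two_dim (eset K `&` translate s (eset K')) ->
    exists! e : edge,
      (eplus e, eminus e, eshift e) = (K, K', s) \/
      (eplus e, eminus e, eshift e) = (K', K, - s);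
  eorig : edge -> vec;
  eframe : edge -> 'M[R]_3;
  eframe_orthonormal : forall e, eframe e *m (eframe e)^T = 1%:M;
  enormal_plus : forall e y, eset (eplus e) y ->
    dot (row 2 (eframe e)) (y - eorig e) <= 0;
  enormal_minus : forall e y, translate (eshift e) (eset (eminus e)) y ->
    dot (- row 2 (eframe e)) (y - eorig e) <= 0
}.

Section MeshOps.
Variables (Omega Lambda : set vec) (M : mesh Omega Lambda).

(* The boolean b selects a side of the edge: true for +, false for -. *)
Definition eelt (e : edge M) (b : bool) : elt M :=
  if b then eplus e else eminus e.

Definition enormal (e : edge M) (b : bool) : vec :=
  if b then row 2 (eframe e) else - row 2 (eframe e).

(* The representative, in the element on side b, of a point x of e. *)
Definition epos (e : edge M) (b : bool) (x : vec) : vec :=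
  if b then x else x - eshift e.

Definition echart (e : edge M) (p : R * R) : vec :=
  eorig e + p.1 *: row 0 (eframe e) + p.2 *: row 1 (eframe e).

Definition sint (e : edge M) (g : vec -> R) : R :=
  \int[(@lebesgue_measure R \x @lebesgue_measure R)%E]_(p
    in echart e @^-1` edge_set e) g (echart e p).

(* Sum of the contributions h e b of the interior edges that make up the
   boundary of K, K being the element on side b of e. *)
Definition bd_sum (K : elt M) (h : edge M -> bool -> R) : R :=
  \sum_(e : edge M) \sum_(b : bool | eelt e b == K) h e b.

End MeshOps.
End Meshes.

Section Domains.
Variable R : realType.
Local Notation vec := 'rV[R]_3.

Definition box (a b : vec) : set vec := [set x | forall i, a 0 i <= x 0 i <= b 0 i].

Definition periods (a b : vec) : set vec :=
  [set s | exists z : 'I_3 -> int, forall i, s 0 i = (z i)%:~R * (b 0 i - a 0 i)].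

(* Omega is the closure of a bounded domain (nonempty connected open set). *)
Definition bounded_domain (Omega : set vec) : Prop :=
  bounded_set Omega /\
  exists D : set vec, [/\ open D, connected D, D !=set0 & Omega = closure D].

End Domains.

Inductive vlasov_flux := VlasovCentral | VlasovUpwind.

(* MaxwellPM: E^+ and B^-; MaxwellMP: E^- and B^+. *)
Inductive maxwell_flux := MaxwellCentral | MaxwellPM | MaxwellMP.

Inductive integrator :=
  Scheme1 | Scheme2 | Scheme3 | Scheme4 | Scheme3F | Scheme4F.

Section DG.
Variables (R : realType) (Ox Lx Ov Lv : set 'rV[R]_3).
Variables (mx : mesh Ox Lx) (mv : mesh Ov Lv).
Variables (k r : nat).
Variables (vf : vlasov_flux) (mf : maxwell_flux).
Local Notation vec := 'rV[R]_3.

(* Discrete functions are families of polynomials indexed by the elements, so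
   that traces from each side are values of the polynomials.  The first three
   variables are those of x, the last three those of v. *)
Definition pdf := elt mx -> elt mv -> mpoly.mpoly (3 + 3) R.
Definition field := elt mx -> 'I_3 -> mpoly.mpoly 3 R.

Definition in_G (f : pdf) : Prop :=
  forall Kx Kv, (mpoly.msize (f Kx Kv) <= k.+1)%N.

Definition in_U (U : field) : Prop :=
  forall Kx i, (mpoly.msize (U Kx i) <= r.+1)%N.

Definition peval (p : mpoly.mpoly (3 + 3) R) (x v : vec) : R :=
  mpoly.meval (fun i => row_mx x v 0 i) p.

Definition eval3 (p : mpoly.mpoly 3 R) (x : vec) : R :=
  mpoly.meval (fun i => x 0 i) p.

Definition fld (U : field) (Kx : elt mx) (x : vec) : vec :=
  \row_i eval3 (U Kx i) x.

Definition curl (U : field) (Kx : elt mx) (x : vec) : vec :=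
  \row_(i < 3) (eval3 (mpoly.mderiv (i + 1) (U Kx (i + 2))) x -
                eval3 (mpoly.mderiv (i + 2) (U Kx (i + 1))) x).

Definition grad_x (p : mpoly.mpoly (3 + 3) R) (x v : vec) : vec :=
  \row_(i < 3) peval (mpoly.mderiv (lshift 3 i) p) x v.

Definition grad_v (p : mpoly.mpoly (3 + 3) R) (x v : vec) : vec :=
  \row_(i < 3) peval (mpoly.mderiv (rshift 3 i) p) x v.

Definition avg_pdf (f g : pdf) : pdf :=
  fun Kx Kv => 2^-1 *: (f Kx Kv + g Kx Kv).

Definition avg_field (U V : field) : field :=
  fun Kx i => 2^-1 *: (U Kx i + V Kx i).

(* The function on Omega_x * Omega_v whose restriction to the interior of each
   Kx * Kv is f Kx Kv; it is set to 0 on the null set of interfaces. *)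
Definition pdf_fun (f : pdf) (x v : vec) : R :=
  \sum_(Kx : elt mx) \sum_(Kv : elt mv)
    \1_(interior (eset Kx)) x * \1_(interior (eset Kv)) v * peval (f Kx Kv) x v.

Definition vanishes_on_boundary (f : pdf) : Prop :=
  forall (Kx : elt mx) (Kv : elt mv) (x v : vec),
    eset Kx x -> eset Kv v -> boundary Ov v -> peval (f Kx Kv) x v = 0.

Definition current (f : pdf) (x : vec) : vec :=
  \row_(i < 3) vint Ov (fun v => pdf_fun f x v * v 0 i).

Definition particle_number (f : pdf) : R :=
  vint Ox (fun x => vint Ov (fun v => pdf_fun f x v)).

Definition kint (Kx : elt mx) (Kv : elt mv) (g : vec -> vec -> R) : R :=
  vint (eset Kx) (fun x => vint (eset Kv) (fun v => g x v)).

(* Sign of the jump term: upwind for steps of positive size, downwind for steps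
   of negative size. *)
Definition jump_sign (tau : R) : R :=
  match vf with
  | VlasovCentral => 0
  | VlasovUpwind => if tau < 0 then -1 else 1
  end.

(* ({g w} + sigma * |w . n| / 2 * [g]) . n, where n is the outward normal of the
   element on side b. *)
Definition num_flux (sigma : R) (w : vec) (gp gm : R) (np nm n : vec) : R :=
  dot (2^-1 *: (gp *: w + gm *: w)
       + (sigma * (`|dot w n| / 2)) *: (gp *: np + gm *: nm)) n.

Definition flux_x (sigma : R) (f : pdf) (e : edge mx) (b : bool) (Kv : elt mv)
    (x v : vec) : R :=
  num_flux sigma v
    (peval (f (eplus e) Kv) (epos e true x) v)
    (peval (f (eminus e) Kv) (epos e false x) v)
    (enormal e true) (enormal e false) (enormal e b).

Definition lorentz (E B : field) (Kx : elt mx) (x v : vec) : vec :=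
  fld E Kx x + cross v (fld B Kx x).

Definition flux_v (sigma : R) (f : pdf) (E B : field) (e : edge mv) (b : bool)
    (Kx : elt mx) (x v : vec) : R :=
  num_flux sigma (lorentz E B Kx x v)
    (peval (f Kx (eplus e)) x (epos e true v))
    (peval (f Kx (eminus e)) x (epos e false v))
    (enormal e true) (enormal e false) (enormal e b).

(* The numerical flux is zero on the faces contained in the boundary of
   Omega_v, so that only interior edges contribute to the last sum. *)
Definition A_K (sigma : R) (f : pdf) (E B : field) (psi : pdf)
    (Kx : elt mx) (Kv : elt mv) : R :=
  - kint Kx Kv (fun x v => peval (f Kx Kv) x v * dot v (grad_x (psi Kx Kv) x v))
  - kint Kx Kv (fun x v => peval (f Kx Kv) x v *
      dot (lorentz E B Kx x v) (grad_v (psi Kx Kv) x v))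
  + bd_sum Kx (fun e b => vint (eset Kv) (fun v => sint e (fun x =>
      flux_x sigma f e b Kv x v * peval (psi Kx Kv) (epos e b x) v)))
  + bd_sum Kv (fun e b => vint (eset Kx) (fun x => sint e (fun v =>
      flux_v sigma f E B e b Kx x v * peval (psi Kx Kv) x (epos e b v)))).

Definition trace_x (U : field) (e : edge mx) (b : bool) (x : vec) : vec :=
  fld U (eelt e b) (epos e b x).

Definition avg_trace (U : field) (e : edge mx) (x : vec) : vec :=
  2^-1 *: (trace_x U e true x + trace_x U e false x).

Definition tilde_E (E : field) (e : edge mx) (x : vec) : vec :=
  match mf with
  | MaxwellCentral => avg_trace E e x
  | MaxwellPM => trace_x E e true x
  | MaxwellMP => trace_x E e false x
  end.

Definition tilde_B (B : field) (e : edge mx) (x : vec) : vec :=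
  match mf with
  | MaxwellCentral => avg_trace B e x
  | MaxwellPM => trace_x B e false x
  | MaxwellMP => trace_x B e true x
  end.

Definition C_E (E U : field) (Kx : elt mx) : R :=
  vint (eset Kx) (fun x => dot (fld E Kx x) (curl U Kx x))
  + bd_sum Kx (fun e b => sint e (fun x =>
      dot (cross (enormal e b) (tilde_E E e x)) (trace_x U e b x))).

Definition C_B (B V : field) (Kx : elt mx) : R :=
  vint (eset Kx) (fun x => dot (fld B Kx x) (curl V Kx x))
  + bd_sum Kx (fun e b => sint e (fun x =>
      dot (cross (enormal e b) (tilde_B B e x)) (trace_x V e b x))).

(* The update from f0 to f1 by a (sub)step of size tau, with increment d (equal
   to tau or tau / 2). *)
Definition vlasov_eq (tau d : R) (f0 f1 f : pdf) (E B : field) : Prop :=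
  forall psi, in_G psi -> forall Kx Kv,
    kint Kx Kv (fun x v =>
      (peval (f1 Kx Kv) x v - peval (f0 Kx Kv) x v) / d * peval (psi Kx Kv) x v)
    + A_K (jump_sign tau) f E B psi Kx Kv = 0.

Definition faraday_eq (d : R) (B0 B1 E : field) : Prop :=
  forall U, in_U U -> forall Kx,
    vint (eset Kx) (fun x =>
      dot (d^-1 *: (fld B1 Kx x - fld B0 Kx x)) (fld U Kx x)) = - C_E E U Kx.

Definition ampere_eq (d : R) (E0 E1 B : field) (J : vec -> vec) : Prop :=
  forall V, in_U V -> forall Kx,
    vint (eset Kx) (fun x =>
      dot (d^-1 *: (fld E1 Kx x - fld E0 Kx x)) (fld V Kx x))
    = C_B B V Kx - vint (eset Kx) (fun x => dot (J x) (fld V Kx x)).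

Definition admissible (f : pdf) : Prop := in_G f /\ vanishes_on_boundary f.

Record state := State { sf : pdf; sE : field; sB : field }.

Definition admissible_state (s : state) : Prop :=
  [/\ admissible (sf s), in_U (sE s) & in_U (sB s)].

Definition scheme1 (tau : R) (s0 s1 : state) : Prop :=
  exists (fh : pdf) (Bh : field),
    [/\ admissible fh, in_U Bh &
    [/\ vlasov_eq tau (tau / 2) (sf s0) fh (sf s0) (sE s0) (sB s0),
        faraday_eq (tau / 2) (sB s0) Bh (sE s0),
        ampere_eq tau (sE s0) (sE s1) Bh (current fh),
        faraday_eq (tau / 2) Bh (sB s1) (sE s1) &
        vlasov_eq tau tau (sf s0) (sf s1) fh (avg_field (sE s0) (sE s1)) Bh]].

Definition scheme2 (tau : R) (s0 s1 : state) : Prop :=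
  exists fh : pdf, admissible fh /\
    [/\ vlasov_eq tau (tau / 2) (sf s0) fh (sf s0) (sE s0) (sB s0),
        faraday_eq tau (sB s0) (sB s1) (avg_field (sE s0) (sE s1)),
        ampere_eq tau (sE s0) (sE s1) (avg_field (sB s0) (sB s1)) (current fh) &
        vlasov_eq tau tau (sf s0) (sf s1) fh
          (avg_field (sE s0) (sE s1)) (avg_field (sB s0) (sB s1))].

Definition scheme3 (tau : R) (s0 s1 : state) : Prop :=
  exists Eh : field, in_U Eh /\
    [/\ ampere_eq (tau / 2) (sE s0) Eh (sB s0) (current (sf s0)),
        faraday_eq tau (sB s0) (sB s1) Eh,
        vlasov_eq tau tau (sf s0) (sf s1) (avg_pdf (sf s0) (sf s1))
          Eh (avg_field (sB s0) (sB s1)) &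
        ampere_eq (tau / 2) Eh (sE s1) (sB s1) (current (sf s1))].

Definition scheme4 (tau : R) (s0 s1 : state) : Prop :=
  [/\ faraday_eq tau (sB s0) (sB s1) (avg_field (sE s0) (sE s1)),
      ampere_eq tau (sE s0) (sE s1) (avg_field (sB s0) (sB s1))
        (fun x => 2^-1 *: (current (sf s0) x + current (sf s1) x)) &
      vlasov_eq tau tau (sf s0) (sf s1) (avg_pdf (sf s0) (sf s1))
        (avg_field (sE s0) (sE s1)) (avg_field (sB s0) (sB s1))].

Definition beta1 : R := (2 + 2 `^ 3^-1 + 2 `^ (- 3^-1)) / 3.
Definition beta2 : R := 1 - 2 * beta1.

Definition compose3 (step : R -> state -> state -> Prop) (tau : R)
    (s0 s1 : state) : Prop :=
  exists sa sb, [/\ admissible_state sa, admissible_state sb &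
    [/\ step (beta1 * tau) s0 sa, step (beta2 * tau) sa sb &
        step (beta1 * tau) sb s1]].

Definition scheme_step (m : integrator) : R -> state -> state -> Prop :=
  match m with
  | Scheme1 => scheme1
  | Scheme2 => scheme2
  | Scheme3 => scheme3
  | Scheme4 => scheme4
  | Scheme3F => compose3 scheme3
  | Scheme4F => compose3 scheme4
  end.

Definition dg_step (m : integrator) (dt : R) (s0 s1 : state) : Prop :=
  [/\ admissible_state s0, admissible_state s1 & scheme_step m dt s0 s1].

End DG.

(* Main.v *)
(** Test the Vlasov equation of the (sub)step with [psi = 1] on every element and
    sum over all elements.  The gradient terms vanish, and on each interior face
    the two contributions cancel because the numerical flux changes sign with
    the normal.  Only the difference of the two particle numbers is left, divided
    by the step size, which is nonzero also in the middle substep of the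
    compositions since [beta2 < 0].

    The cancellation does not need the fluxes to be integrable: the real-valued
    integral is always odd.  Linearity is only needed for the volume terms, whose
    integrands are polynomials on bounded polytopes; the particle number is
    defined through the interiors of the elements, which differ from the elements
    by null sets. *)

Require Import Defs.
From mathcomp Require Import all_boot all_order all_algebra.
From mathcomp Require Import all_classical all_reals all_analysis.
From mathcomp.multinomials Require mpoly.
From mathcomp Require Import measurable_realfun lra.
Import Order.TTheory GRing.Theory Num.Theory.
Import numFieldNormedType.Exports.
Local Open Scope classical_set_scope.
Local Open Scope ring_scope.

(** * The dot product, and mesh elements as bounded intersections of half-spaces *)

Section Polytopes.
Set Implicit Arguments.
Unset Strict Implicit.
Variable R : realType.
Local Notation vec := 'rV[R]_3.

Lemma dotDl (u v w : vec) : dot (u + v) w = dot u w + dot v w.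
Proof. by rewrite -big_split; apply: eq_bigr => i _; rewrite mxE mulrDl. Qed.

Lemma dotZl a (u w : vec) : dot (a *: u) w = a * dot u w.
Proof. by rewrite mulr_sumr; apply: eq_bigr => i _; rewrite mxE mulrA. Qed.

Lemma dotZr a (u w : vec) : dot w (a *: u) = a * dot w u.
Proof. by rewrite mulr_sumr; apply: eq_bigr => i _; rewrite mxE mulrCA. Qed.

Lemma dotNl (u w : vec) : dot (- u) w = - dot u w.
Proof. by rewrite -scaleN1r dotZl mulN1r. Qed.

Lemma dotNr (u w : vec) : dot w (- u) = - dot w u.
Proof. by rewrite -scaleN1r dotZr mulN1r. Qed.

Lemma dot0r (u : vec) : dot u 0 = 0.
Proof. by rewrite -(scale0r 0) dotZr mul0r. Qed.

Lemma dotvv_gt0 (w : vec) : w != 0 -> 0 < dot w w.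
Proof.
move=> /rV0Pn[i wi]; rewrite /dot (bigD1 i)//= -expr2 ltr_pwDl//.
  by rewrite lt_def sqrf_eq0 wi sqr_ge0.
by rewrite sumr_ge0// => j _; rewrite -expr2 sqr_ge0.
Qed.

(** A common description of simplices and rotated boxes. Nonzero normals ensure that strict
    inequalities describe the interior and that the faces lie in null hyperplanes. *)
Definition polytope (K : set vec) : Prop :=
  (exists M, forall x, K x -> forall i, `|x 0 i| <= M) /\
  exists (J : finType) (c : J -> R) (w : J -> vec),
    (forall j, w j != 0) /\ K = [set x | forall j, 0 <= c j + dot x (w j)].

Lemma affine_image_bounded (p : vec) (A : 'M[R]_3) (T : set vec) :
  (forall t, T t -> forall i, `|t 0 i| <= 1) ->
  exists M, forall x, [set p + t *m A | t in T] x -> forall i, `|x 0 i| <= M.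
Proof.
move=> T1; exists (\sum_i (`|p 0 i| + \sum_j `|A j i|)) => _ [t Tt <-] i.
apply: (@le_trans _ _ (`|p 0 i| + \sum_j `|A j i|)); last first.
  rewrite [leRHS](bigD1 i)//= lerDl sumr_ge0// => k _.
  by rewrite addr_ge0// sumr_ge0.
rewrite !mxE (le_trans (ler_normD _ _))// lerD2l.
rewrite (le_trans (ler_norm_sum _ _ _))// ler_sum// => j _.
by rewrite normrM ler_piMl// T1.
Qed.

Lemma affine_image_inv (p : vec) (A : 'M[R]_3) (T : set vec) : A \in unitmx ->
  [set p + t *m A | t in T] = [set x | T ((x - p) *m invmx A)].
Proof.
move=> Au; apply/seteqP; split => [_ [t Tt <-]|x Tx] /=.
  by rewrite [p + _]addrC addrK mulmxK.
by exists ((x - p) *m invmx A) => //; rewrite mulmxKV// addrC subrK.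
Qed.

Lemma mulmx_dot (x : vec) (u : 'cV[R]_3) : (x *m u) 0 0 = dot x u^T.
Proof. by rewrite mxE; apply: eq_bigr => i _; rewrite mxE. Qed.

Lemma mulmx_unit_neq0 (A : 'M[R]_3) (u : 'cV[R]_3) :
  A \in unitmx -> u != 0 -> (invmx A *m u)^T != 0.
Proof.
move=> Au; apply: contraNN => /eqP/(congr1 trmx); rewrite trmxK trmx0.
by move/(congr1 (mulmx A)); rewrite mulKVmx// mulmx0 => ->.
Qed.

(** Membership in the image is membership of [(x - p) *m invmx A] in [T]. Each half-space thus pulls
    back to one with normal [invmx A *m (w j)^T], written as a row, and an offset corrected by
    [p]. *)
Lemma affine_image_polytope (p : vec) (A : 'M[R]_3) (T : set vec) :
  A \in unitmx -> polytope T -> (forall t, T t -> forall i, `|t 0 i| <= 1) ->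
  polytope [set p + t *m A | t in T].
Proof.
move=> Au [_ [J [c [w [w0 ->]]]]] T1; split; first exact: affine_image_bounded.
exists J, (fun j => c j - dot p (invmx A *m (w j)^T)^T),
  (fun j => (invmx A *m (w j)^T)^T).
split=> [j|].
  by apply: mulmx_unit_neq0 => //; rewrite -trmx0 (inj_eq trmx_inj).
rewrite affine_image_inv//; apply/seteqP.
have E x j : c j - dot p (invmx A *m (w j)^T)^T + dot x (invmx A *m (w j)^T)^T
    = c j + dot ((x - p) *m invmx A) (w j).
  rewrite -[w j in RHS]trmxK -mulmx_dot -mulmxA mulmx_dot dotDl dotNl.
  by rewrite -addrA [- _ + _]addrC.
by split=> x /= H j; have := H j; rewrite E.
Qed.

Lemma dot_delta (x : vec) i : dot x (delta_mx 0 i) = x 0 i.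
Proof.
rewrite /dot (bigD1 i)//= mxE !eqxx mulr1 big1 ?addr0// => j ji.
by rewrite mxE (negbTE ji) andbF mulr0.
Qed.

Lemma delta_mx_neq0 i : delta_mx 0 i != 0 :> vec.
Proof.
apply/eqP => /matrixP/(_ 0 i); rewrite !mxE !eqxx => /eqP.
by rewrite oner_eq0.
Qed.

Lemma unit_cube_norm (t : vec) :
  (forall i, 0 <= t 0 i <= 1) -> forall i, `|t 0 i| <= 1.
Proof. by move=> H i; have /andP[h0 h1] := H i; rewrite ger0_norm. Qed.

Lemma unit_simplex_norm (t : vec) :
  (forall i, 0 <= t 0 i) /\ \sum_i t 0 i <= 1 -> forall i, `|t 0 i| <= 1.
Proof.
move=> [H0 H1]; apply: unit_cube_norm => i; rewrite H0/= (le_trans _ H1)//.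
by rewrite (bigD1 i)//= lerDl sumr_ge0.
Qed.

Lemma rotated_box_polytope (K : set vec) : is_rotated_box K -> polytope K.
Proof.
move=> [p [A [Au _ ->]]]; apply: affine_image_polytope => //; last first.
  exact: unit_cube_norm.
split; first by exists 1; apply: unit_cube_norm.
(* The index [(i, true)] stands for [0 <= t 0 i], and [(i, false)] for [0 <= 1 - t 0 i]. *)
exists ('I_3 * bool)%type, (fun j => (~~ j.2)%:R),
  (fun j => (-1) ^+ (~~ j.2) *: delta_mx 0 j.1).
split=> [j|]; first by rewrite scaler_eq0 signr_eq0 delta_mx_neq0.
apply/seteqP; split=> t /= H.
  move=> [i []] /=; rewrite dotZr dot_delta.
    by have /andP[] := H i; rewrite expr0 mul1r add0r.
  by have /andP[] := H i; rewrite expr1 mulN1r subr_ge0.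
move=> i; have := H (i, true); have := H (i, false) => /=.
rewrite !dotZr !dot_delta expr1 expr0 mulN1r mul1r add0r subr_ge0.
by move=> -> ->.
Qed.

Lemma simplex_polytope (K : set vec) : is_simplex K -> polytope K.
Proof.
move=> [p [A [Au ->]]]; apply: affine_image_polytope => //; last first.
  exact: unit_simplex_norm.
split; first by exists 1; apply: unit_simplex_norm.
(* [Some i] stands for [0 <= t 0 i], and [None] for the slanted face [0 <= 1 - \sum_i t 0 i]. *)
exists (option 'I_3), (fun j => (j == None)%:R),
  (fun j => if j is Some i then delta_mx 0 i else - const_mx 1).
have dot1 (t : vec) : dot t (const_mx 1) = \sum_i t 0 i.
  by apply: eq_bigr => i _; rewrite mxE mulr1.
split=> [[i|]|]; first exact: delta_mx_neq0.
  rewrite oppr_eq0; apply/eqP => /matrixP/(_ 0 0); rewrite !mxE => /eqP.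
  by rewrite oner_eq0.
apply/seteqP; split=> t /=.
  move=> [H0 H1] [i|] /=; first by rewrite add0r dot_delta.
  by rewrite dotNr dot1 subr_ge0.
move=> H; split=> [i|].
  by have := H (Some i); rewrite /= add0r dot_delta.
by have := H None; rewrite /= dotNr dot1 subr_ge0.
Qed.

(** * The interior of a polytope *)

Lemma affine_continuous c (w : vec) : continuous (fun x : vec => c + dot x w).
Proof.
move=> x; pose F : set_system vec := nbhs x; have FF : Filter F := nbhs_filter x.
apply: (@cvgD _ _ _ F _ (fun=> c)); first exact: cvg_cst.
apply: (@cvg_big _ _ _ _ xpredT _ _ F) => [|i _]; first exact: add_continuous.
apply: (@cvgM _ _ F _ _ (fun=> w 0 i)); last exact: cvg_cst.
exact: coord_continuous.
Qed.

(** From an interior point one can move slightly against any normal and stay inside, so no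
    constraint is an equality there. Conversely, finitely many strict affine inequalities persist
    near the point by continuity. *)
Lemma interior_halfspaces (J : finType) (c : J -> R) (w : J -> vec) :
  (forall j, w j != 0) ->
  interior [set x | forall j, 0 <= c j + dot x (w j)] =
  [set x | forall j, 0 < c j + dot x (w j)].
Proof.
move=> w0; apply/seteqP; split=> x /=.
  move=> Kx j.
  have cx : (fun e : R => x - e *: w j) @ 0 --> x.
    rewrite -[X in _ --> X]subr0 -(scale0r (w j)).
    by apply: cvgB; [exact: cvg_cst|apply: cvgZr_tmp; exact: cvg_id].
  have /nbhs_ballP[e /= e0 /(_ (e / 2))] := cx _ Kx.
  have e2 : 0 < e / 2 by rewrite divr_gt0.
  rewrite /ball/= sub0r normrN gtr0_norm// ltr_pdivrMr// ltr_pMr// ltr1n.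
  move=> /(_ isT j); rewrite dotDl dotNl dotZl addrA subr_ge0.
  by apply: lt_le_trans; rewrite mulr_gt0// dotvv_gt0.
move=> H; have FF : Filter (nbhs x) := nbhs_filter x.
apply: (@filter_forall _ _ _ (nbhs x)) => j.
have : \forall y \near x, 0 < c j + dot y (w j).
  exact: (@affine_continuous (c j) (w j) x _ (lt_nbhsr _)).
by apply: filterS => y /ltW.
Qed.

(** * Measurability, null sets and finite measure in coordinates *)

Local Notation mu := (@lebesgue_measure R).
Local Notation vec3 := (@vec3 R).
Local Notation mu3 := ((mu \x mu) \x mu)%E.

Lemma vec3_coord (p : R * R * R) (i : 'I_3) :
  vec3 p 0 i = [:: p.1.1; p.1.2; p.2]`_i.
Proof. by rewrite mxE. Qed.

Lemma measurable_vec3_coord i :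
  measurable_fun [set: R * R * R] (fun p => vec3 p 0 i).
Proof.
under eq_fun do rewrite vec3_coord.
case: i => -[|[|[|//]]] /= _.
- exact: measurableT_comp.
- exact: measurableT_comp.
- exact: measurable_snd.
Qed.

Lemma measurable_affine c (w : vec) :
  measurable_fun [set: R * R * R] (fun p => c + dot (vec3 p) w).
Proof.
apply: measurable_funD => //; apply: measurable_sum => i.
by apply: measurable_funM => //; exact: measurable_vec3_coord.
Qed.


(* The measurable structure inferred for R has a different display from that of
   the domain of lebesgue_measure. *)
Local Notation R3 :=
  (measurableTypeR R * measurableTypeR R * measurableTypeR R)%type.

Definition vmeasurable (A : set vec) : Prop :=
  measurable (vec3 @^-1` A : set R3).

Definition vintegrable (A : set vec) (g : vec -> R) : Prop :=
  mu3.-integrable (vec3 @^-1` A) (fun p => (g (vec3 p))%:E).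

Lemma vmeasurable_forall (J : finType) (P : J -> set vec) :
  (forall j, vmeasurable (P j)) -> vmeasurable [set x | forall j, P j x].
Proof.
move=> mP; rewrite /vmeasurable.
have -> : vec3 @^-1` [set x | forall j, P j x] =
    \bigcap_(j in [set: J]) vec3 @^-1` P j.
  by apply/seteqP; split=> p H j; [move=> _; exact: H|exact: H].
apply: fin_bigcap_measurable => [|j _]; [exact: finite_finset|exact: mP].
Qed.

Lemma vmeasurable_affine c (w : vec) (B : set R) :
  measurable B -> vmeasurable [set x | B (c + dot x w)].
Proof.
move=> mB; have := @measurable_affine c w measurableT B mB.
by rewrite setTI.
Qed.

Lemma vec3_dot (p : R * R * R) (w : vec) : dot (vec3 p) w =
  p.1.1 * w 0 0 + p.1.2 * w 0 1 + p.2 * w 0 2.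
Proof.
rewrite /dot !big_ord_recl big_ord0 addr0 !vec3_coord/= addrA.
by congr (_ * w 0 _ + _ * w 0 _ + _ * w 0 _); apply/val_inj.
Qed.

(** The section over each [x] is the single point [- f x / b], which has Lebesgue measure zero. *)
Lemma product_measure_graph d (T : measurableType d) (m : {measure set T -> \bar R})
    (f : T -> R) (b : R) : measurable_fun [set: T] f -> b != 0 ->
  (m \x mu)%E [set p | f p.1 + p.2 * b = 0] = 0%E.
Proof.
move=> mf b0; rewrite /product_measure1/= integral0_eq// => x _ /=.
rewrite (_ : xsection _ x = [set - f x / b]) ?lebesgue_measure_set1//.
apply/seteqP; split=> y /=; rewrite /xsection/= inE/=.
  by move/eqP; rewrite addrC addr_eq0 => /eqP <-; rewrite mulfK.
by move=> ->; rewrite divfK// subrr.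
Qed.

(** The equation is solved for the last coordinate whose coefficient is nonzero; the set is then a
    graph over the earlier coordinates, times a full line for each later one. *)
Lemma hyperplane_null c (w : vec) : w != 0 ->
  mu3 (vec3 @^-1` [set x | c + dot x w = 0]) = 0%E.
Proof.
move=> w0.
have mf c' : measurable_fun [set: R * R] (fun q => c' + (q.1 * w 0 0 + q.2 * w 0 1)).
  by apply: measurable_funD => //; apply: measurable_funD; apply: measurable_funM.
have E : vec3 @^-1` [set x | c + dot x w = 0] =
    [set p : R * R * R | c + (p.1.1 * w 0 0 + p.1.2 * w 0 1) + p.2 * w 0 2 = 0].
  by apply/seteqP; split=> p /=; rewrite vec3_dot !addrA.
rewrite E; have [w2|w2] := eqVneq (w 0 2) 0; last first.
  exact: (product_measure_graph (mu \x mu)%E (mf c) w2).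
pose A := [set q : R * R | c + q.1 * w 0 0 + q.2 * w 0 1 = 0].
have mA : measurable A.
  have := mf c measurableT [set 0] (measurable_set1 _); rewrite setTI.
  by congr measurable; apply/seteqP; split=> q; rewrite /A/= addrA.
have -> : [set p : R * R * R |
    c + (p.1.1 * w 0 0 + p.1.2 * w 0 1) + p.2 * w 0 2 = 0] = A `*` setT.
  apply/seteqP; split=> p; rewrite /A/= w2 mulr0 addr0 addrA//.
  by case.
rewrite product_measure1E//.
(* The factor [setT] has infinite measure, but [0 * +oo = 0], so it is enough that [A] is null in
   the plane. *)
rewrite [X in (X * _)%E](_ : _ = 0%E) ?mul0e//.
have [w1|w1] := eqVneq (w 0 1) 0; last first.
  apply: (@product_measure_graph _ _ mu (fun y => c + y * w 0 0) _ _ w1).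
  by apply: measurable_funD => //; apply: measurable_funM.
have w00 : w 0 0 != 0.
  apply: contraNN w0 => /eqP w00; apply/eqP/rowP => i; rewrite mxE.
  by case: i => -[|[|[|//]]] i3;
    [rewrite -w00|rewrite -w1|rewrite -w2]; congr (w 0 _); apply/val_inj.
have -> : A = [set - c / w 0 0] `*` setT.
  apply/seteqP; split=> q; rewrite /A/= w1 mulr0 addr0.
    by move/eqP; rewrite addrC addr_eq0 => /eqP <-; rewrite mulfK.
  by move=> [-> _]; rewrite divfK// subrr.
apply: (eq_trans (product_measure1E mu mu (measurable_set1 _) measurableT)).
by rewrite [X in (X * _)%E]lebesgue_measure_set1 mul0e.
Qed.

Lemma vbounded_finite_measure (A : set vec) (M : R) : vmeasurable A ->
  (forall x, A x -> forall i, `|x 0 i| <= M) ->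
  (mu3 (vec3 @^-1` A) < +oo)%E.
Proof.
move=> mA AM; pose I := `[- M, M]%classic.
have mI : measurable I by exact: measurable_itv.
have I0 : (mu I < +oo)%E.
  by rewrite lebesgue_measure_itv/=; case: ifPn => // _; rewrite -EFinB ltry.
apply: (@le_lt_trans _ _ (mu3 ((I `*` I) `*` I))).
  apply: le_measure; rewrite ?inE//; first by do 2?apply: measurableX.
  move=> p /AM H; rewrite /I/= !in_itv/= -!ler_norml.
  have := H 0; have := H 1; have := H 2; rewrite !vec3_coord/= => -> -> ->.
  by [].
have Ifin : mu I \is a fin_num by rewrite ge0_fin_numE.
have I2fin : (mu \x mu)%E (I `*` I) \is a fin_num.
  by rewrite (product_measure1E mu mu mI mI) fin_numM.
rewrite (product_measure1E (mu \x mu)%E mu (measurableX mI mI) mI).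
by have := fin_numM I2fin Ifin; rewrite fin_numElt => /andP[].
Qed.

Lemma polytope_measurable K : polytope K -> vmeasurable K.
Proof.
move=> [_ [J [c [w [_ ->]]]]]; apply: vmeasurable_forall => j.
have := @vmeasurable_affine (c j) (w j) _ (measurable_itv `[0, +oo[).
by congr vmeasurable; apply/seteqP; split=> x; rewrite /= in_itv/= andbT.
Qed.

Lemma polytope_interior_measurable K : polytope K -> vmeasurable (interior K).
Proof.
move=> [_ [J [c [w [w0 ->]]]]]; rewrite interior_halfspaces//.
apply: vmeasurable_forall => j.
have := @vmeasurable_affine (c j) (w j) _ (measurable_itv `]0, +oo[).
by congr vmeasurable; apply/seteqP; split=> x; rewrite /= in_itv/= andbT.
Qed.

(** At a point of [K] outside the interior some constraint is an equality, so the difference is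
    covered by finitely many null hyperplanes. *)
Lemma polytope_boundary_null K : polytope K ->
  mu3 (vec3 @^-1` (K `\` interior K)) = 0%E.
Proof.
move=> pK; have mD : vmeasurable (K `\` interior K).
  by apply: measurableD;
    [exact: polytope_measurable|exact: polytope_interior_measurable].
case: pK mD => [_ [J [c [w [w0 ->]]]]]; rewrite interior_halfspaces// => mD.
pose H j := vec3 @^-1` [set x | c j + dot x (w j) = 0].
have mH j : measurable (H j) by exact: (@vmeasurable_affine (c j) (w j) _ (measurable_set1 0)).
have : mu3.-negligible (\big[setU/set0]_(j : J) H j).
  elim/big_ind: _ => [|A B|j _]; first exact: negligible_set0.
  - exact: negligibleU.
  - by exists (H j); split; [exact: mH|exact: hyperplane_null (w0 j)|].
move=> [N [mN N0 HN]]; apply/eqP; rewrite -measure_le0 -N0.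
apply: le_measure; rewrite ?inE// => p [/= Kp /existsNP[j nj]].
apply: HN; rewrite (bigD1 j)//=; left; rewrite /H/=.
by apply/eqP; rewrite eq_le Kp andbT leNgt; apply/negP.
Qed.

(** Reconciles [pdf_fun], which lives on the interiors of the elements, with [kint], which
    integrates over the closed elements. *)
Lemma vint_interior K g : polytope K -> vintegrable K g ->
  vint (interior K) g = vint K g.
Proof.
move=> pK ig; have mK := polytope_measurable pK.
have mD := measurableD mK (polytope_interior_measurable pK).
apply: esym; congr fine.
apply: (eq_trans (negligible_integral mD mK ig (polytope_boundary_null pK))).
congr (integral _ _ _); apply/seteqP; split=> p /=.
  by move=> [Kp nKp]; apply: contrapT => nI; apply: nKp.
by move=> Ip; split; [exact: interior_subset Ip|case].
Qed.

(** * Restriction and linearity of integrals *)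

Lemma indic_restrict (A Omega : set vec) (g : vec -> R) (p : R * R * R) :
  A `<=` Omega ->
  ((fun p => \1_A (vec3 p) * g (vec3 p)) \_ (vec3 @^-1` Omega)) p =
  ((fun p => g (vec3 p)) \_ (vec3 @^-1` A)) p.
Proof.
move=> AO; have E B : (p \in vec3 @^-1` B) = (vec3 p \in B) by [].
rewrite /patch !E indicE.
have [Ap|nAp] := boolP (vec3 p \in A).
  have -> : vec3 p \in Omega by rewrite inE; apply: AO; rewrite -inE.
  by rewrite mul1r.
(* Off [A] the left side is zero both inside [Omega], through the indicator, and outside it, through
   the default value of the restriction. *)
by rewrite mul0r; case: ifP.
Qed.

Lemma vint_indic (A Omega : set vec) (g : vec -> R) : A `<=` Omega ->
  vint Omega (fun x => \1_A x * g x) = vint A g.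
Proof.
move=> AO; rewrite /vint Rintegral_mkcond [RHS]Rintegral_mkcond.
by apply: eq_Rintegral => p _; exact: indic_restrict.
Qed.

Lemma vintegrable_indic (A Omega : set vec) (g : vec -> R) :
  vmeasurable A -> vmeasurable Omega -> A `<=` Omega ->
  vintegrable A g -> vintegrable Omega (fun x => \1_A x * g x).
Proof.
move=> mA mO AO /(integrable_mkcond _ mA) ig.
apply/(integrable_mkcond _ mO); congr (_.-integrable _ _): ig.
apply/funext => p; have := congr1 EFin (indic_restrict g p AO).
by rewrite /patch; case: ifP; case: ifP => // _ _ ->.
Qed.

Lemma vintegrable_sum (I : Type) (s : seq I) (A : set vec) (g : I -> vec -> R) :
  vmeasurable A -> (forall i, vintegrable A (g i)) ->
  vintegrable A (fun x => \sum_(i <- s) g i x).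
Proof.
move=> mA ig; rewrite /vintegrable; under eq_fun do rewrite -sumEFin.
by apply: integrable_sum => // i _; exact: ig.
Qed.

Lemma vintegrableZ (A : set vec) a (g : vec -> R) :
  vmeasurable A -> vintegrable A g -> vintegrable A (fun x => a * g x).
Proof. by move=> mA ig; exact: (integrableZl mA a ig). Qed.

Lemma vintZ (A : set vec) a (g : vec -> R) :
  vmeasurable A -> vintegrable A g ->
  vint A (fun x => a * g x) = a * vint A g.
Proof. by move=> mA ig; exact: (RintegralZl a mA ig). Qed.

Lemma vint0 (A : set vec) (g : vec -> R) : (forall x, g x = 0) -> vint A g = 0.
Proof.
by move=> g0; rewrite /vint /Rintegral integral0_eq// => p _; rewrite g0.
Qed.

Lemma vint_sum (I : Type) (s : seq I) (A : set vec) (g : I -> vec -> R) :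
  vmeasurable A -> (forall i, vintegrable A (g i)) ->
  vint A (fun x => \sum_(i <- s) g i x) = \sum_(i <- s) vint A (g i).
Proof.
move=> mA ig; elim: s => [|i s IH].
  by rewrite big_nil vint0// => x; rewrite big_nil.
rewrite big_cons -IH -[RHS](RintegralD mA (ig i) (vintegrable_sum s mA ig)).
by apply: eq_Rintegral => p _; rewrite big_cons.
Qed.

Lemma eq_vint (A : set vec) (g h : vec -> R) : g =1 h -> vint A g = vint A h.
Proof. by move=> gh; apply: eq_Rintegral => p _; exact: gh. Qed.

(** * Polynomial functions and their integrability *)

Definition monomial (m : 'I_3 -> nat) (x : vec) : R := \prod_i x 0 i ^+ m i.

Lemma monomial_vintegrable K m : polytope K -> vintegrable K (monomial m).
Proof.
move=> pK; have mK := polytope_measurable pK.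
have [[M KM] _] := pK.
have mf : measurable_fun (vec3 @^-1` K : set R3) (fun p => monomial m (vec3 p)).
  apply: (@measurable_funTS _ _ R3).
  apply: measurable_prod => i _; apply: measurable_funX.
  exact: measurable_vec3_coord.
apply: (measurable_bounded_integrable mK (vbounded_finite_measure mK KM) mf).
exists (\prod_(i < 3) M ^+ m i); split; first exact: num_real.
move=> B MB p /= Kp; apply: le_trans (ltW MB).
rewrite normr_prod; apply: ler_prod => i _; rewrite normr_ge0/= normrX.
(* Monotonicity of powers requires [0 <= M], which follows from the existence of the point [p] in
   [K]. *)
by rewrite lerXn2r ?nnegrE ?normr_ge0 ?KM//; exact: le_trans (KM _ Kp i).
Qed.

(** Lists of coefficients and exponents may contain repetitions, so that sums are obtained by
    concatenation. The notion covers both partial evaluations and partial integrals of polynomials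
    in six variables. *)
Definition polyfun (g : vec -> R) : Prop :=
  exists s : seq (R * ('I_3 -> nat)), g =1 fun x => \sum_(t <- s) t.1 * monomial t.2 x.

Lemma polyfun_vintegrable K g : polytope K -> polyfun g -> vintegrable K g.
Proof.
move=> pK [s /funext ->]; have mK := polytope_measurable pK.
apply: vintegrable_sum => // t; apply: vintegrableZ => //.
exact: monomial_vintegrable.
Qed.

(** Separates the variables: each multi-index splits into its halves for [x] and [v], so iterated
    integrals can be treated one variable at a time. *)
Lemma pevalE (p : mpoly.mpoly (3 + 3) R) (x v : vec) :
  peval p x v = \sum_(m <- mpoly.msupp p) mpoly.mcoeff m p *
    (monomial (fun i => mpoly.fun_of_multinom m (lshift 3 i)) x *
     monomial (fun i => mpoly.fun_of_multinom m (rshift 3 i)) v).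
Proof.
rewrite /peval mpoly.mevalE; apply: eq_bigr => m _; congr (_ * _).
rewrite big_split_ord /monomial /=; congr (_ * _); apply: eq_bigr => i _.
  by rewrite row_mxEl.
by rewrite row_mxEr.
Qed.

Lemma peval_polyfun p x : polyfun (peval p x).
Proof.
exists [seq (mpoly.mcoeff m p *
    monomial (fun i => mpoly.fun_of_multinom m (lshift 3 i)) x,
    fun i => mpoly.fun_of_multinom m (rshift 3 i)) | m <- mpoly.msupp p] => v.
by rewrite pevalE [RHS]big_map; apply: eq_bigr => m _; rewrite mulrA.
Qed.

(** After separation, integration in [v] only changes the coefficients of the monomials in [x];
    hence the outer integrand is again integrable on polytopes. *)
Lemma vint_peval_polyfun K p : polytope K ->
  polyfun (fun x => vint K (peval p x)).
Proof.
move=> pK; have mK := polytope_measurable pK.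
exists [seq (mpoly.mcoeff m p *
    vint K (monomial (fun i => mpoly.fun_of_multinom m (rshift 3 i))),
    fun i => mpoly.fun_of_multinom m (lshift 3 i)) | m <- mpoly.msupp p] => x.
rewrite big_map (eq_vint _ (fun v => pevalE p x v)) vint_sum//=.
  apply: eq_bigr => m _; rewrite vintZ//; last first.
    by apply: vintegrableZ => //; exact: monomial_vintegrable.
  by rewrite vintZ//; [rewrite -mulrA [X in _ * X]mulrC|exact: monomial_vintegrable].
by move=> m; do 2![apply: vintegrableZ => //]; exact: monomial_vintegrable.
Qed.

(* No integrability is required: [fine] sends both infinities to 0. *)
Lemma RintegralN_uncond d (T : measurableType d) (m : {measure set T -> \bar R})
    (D : set T) (f : T -> R) :
  \int[m]_(x in D) (- f x) = - \int[m]_(x in D) f x.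
Proof.
pose F x := (f x)%:E; rewrite /Rintegral.
have -> : (fun x => (- f x)%:E) = (\- F)%E by [].
rewrite integralE [in RHS]integralE funeposN funenegN.
have /(integral_ge0 m) : forall x, D x -> (0 <= F^\+ x)%E by move=> x _; exact: funepos_ge0.
have /(integral_ge0 m) : forall x, D x -> (0 <= F^\- x)%E by move=> x _; exact: funeneg_ge0.
move: (integral _ _ _) (integral _ _ _) => [a| |] [b| |]//= _ _; rewrite ?oppr0//.
by rewrite opprB.
Qed.

Lemma vintN (A : set vec) (g : vec -> R) : vint A (fun x => - g x) = - vint A g.
Proof. exact: RintegralN_uncond. Qed.

End Polytopes.

(** * From integrals over phase space to sums over elements *)

Section Conservation.
Set Implicit Arguments.
Unset Strict Implicit.
Variables (R : realType) (Ox Lx Ov Lv : set 'rV[R]_3).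
Variables (mx : mesh Ox Lx) (mv : mesh Ov Lv).
Local Notation vec := 'rV[R]_3.
Local Notation pdf := (pdf mx mv).
Local Notation field := (field mx).

Lemma eset_polytope (O L : set vec) (M : mesh O L) (K : elt M) : polytope (eset K).
Proof.
by case: (eset_shape K); [exact: simplex_polytope|exact: rotated_box_polytope].
Qed.

Lemma interior_eset_subset (O L : set vec) (M : mesh O L) (K : elt M) :
  interior (eset K) `<=` O.
Proof.
move=> x /interior_subset Kx; rewrite -(eset_cover M).
by exists K.
Qed.

Lemma mesh_measurable (O L : set vec) (M : mesh O L) : vmeasurable O.
Proof.
rewrite -(eset_cover M) /vmeasurable preimage_bigcup.
apply: fin_bigcup_measurable => [|K _]; first exact: finite_finset.
exact: polytope_measurable (eset_polytope K).
Qed.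

(** Each indicator shrinks the domain to the interior of its element, and the null boundary can then
    be added back. *)
Lemma vint_elements (O L : set vec) (M : mesh O L) (g : elt M -> vec -> R) :
  (forall K, polyfun (g K)) ->
  vint O (fun x => \sum_K \1_(interior (eset K)) x * g K x) =
  \sum_K vint (eset K) (g K).
Proof.
move=> pg; have pK := @eset_polytope _ _ M.
have mO := mesh_measurable M.
rewrite vint_sum// => [|K].
  apply: eq_bigr => K _; rewrite vint_indic ?vint_interior//.
    exact: polyfun_vintegrable.
  exact: interior_eset_subset.
apply: vintegrable_indic => //.
- exact: polytope_interior_measurable.
- exact: interior_eset_subset.
apply: (integrableS (polytope_measurable (pK K))).
- exact: polytope_interior_measurable.
- by move=> p; exact: interior_subset.
- exact: polyfun_vintegrable.
Qed.

Lemma polyfun_sum (I : Type) (s : seq I) (g : I -> vec -> R) :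
  (forall i, polyfun (g i)) -> polyfun (fun x => \sum_(i <- s) g i x).
Proof.
move=> pg; elim: s => [|i s [t IH]].
  by exists [::] => x; rewrite !big_nil.
have [u gu] := pg i; exists (u ++ t) => x.
by rewrite big_cat big_cons -gu -IH.
Qed.

Lemma polyfunZ a (g : vec -> R) : polyfun g -> polyfun (fun x => a * g x).
Proof.
move=> [s gs]; exists [seq (a * t.1, t.2) | t <- s] => x.
by rewrite gs big_map mulr_sumr; apply: eq_bigr => t _; rewrite mulrA.
Qed.

(** [vint_elements] is applied twice: in [v] with [x] frozen, then in [x]. *)
Lemma particle_number_kint (f : pdf) :
  particle_number f = \sum_Kx \sum_Kv kint Kx Kv (peval (f Kx Kv)).
Proof.
have pv Kx Kv : polyfun (fun x => vint (eset Kv) (peval (f Kx Kv) x)).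
  exact: vint_peval_polyfun (eset_polytope Kv).
transitivity (vint Ox (fun x => \sum_Kx \1_(interior (eset Kx)) x *
    \sum_Kv vint (eset Kv) (peval (f Kx Kv) x))).
  apply: eq_vint => x.
  transitivity (vint Ov (fun v => \sum_Kv \1_(interior (eset Kv)) v *
      (\sum_Kx \1_(interior (eset Kx)) x * peval (f Kx Kv) x v))).
    apply: eq_vint => v; rewrite /pdf_fun exchange_big; apply: eq_bigr => Kv _.
    rewrite mulr_sumr; apply: eq_bigr => Kx _.
    by rewrite -mulrA mulrCA.
  rewrite vint_elements => [|Kv]; last first.
    by apply: polyfun_sum => Kx; apply: polyfunZ; exact: peval_polyfun.
  under [RHS]eq_bigr do rewrite mulr_sumr.
  rewrite [RHS]exchange_big; apply: eq_bigr => Kv _.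
  have pK := eset_polytope Kv; have mK := polytope_measurable pK.
  have ip p : vintegrable (eset Kv) (peval p x).
    exact: polyfun_vintegrable (peval_polyfun p x).
  rewrite vint_sum// => [|Kx]; last exact: vintegrableZ.
  by apply: eq_bigr => Kx _; rewrite vintZ.
rewrite vint_elements => [|Kx]; last exact: polyfun_sum.
apply: eq_bigr => Kx _; have pK := eset_polytope Kx.
rewrite vint_sum// => [|Kv]; first exact: polytope_measurable.
exact: polyfun_vintegrable.
Qed.

Lemma eq_kint (Kx : elt mx) (Kv : elt mv) (g h : vec -> vec -> R) :
  (forall x v, g x v = h x v) -> kint Kx Kv g = kint Kx Kv h.
Proof. by move=> gh; apply: eq_vint => x; apply: eq_vint => v; exact: gh. Qed.

Lemma kint0 (Kx : elt mx) (Kv : elt mv) (g : vec -> vec -> R) :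
  (forall x v, g x v = 0) -> kint Kx Kv g = 0.
Proof. by move=> g0; apply: vint0 => x; apply: vint0 => v; exact: g0. Qed.

Lemma kint_scaled_diff Kx Kv (p q : mpoly.mpoly (3 + 3) R) (d : R) :
  kint Kx Kv (fun x v => (peval p x v - peval q x v) / d) =
  (@kint _ _ _ _ _ mx mv Kx Kv (peval p) - kint Kx Kv (peval q)) / d.
Proof.
have pX := eset_polytope Kx; have mX := polytope_measurable pX.
have pV := eset_polytope Kv; have mV := polytope_measurable pV.
have E (g h : vec -> R) (K : set vec) : polytope K -> polyfun g -> polyfun h ->
    vint K (fun x => (g x - h x) / d) = (vint K g - vint K h) / d.
  move=> pK pg ph; have mK := polytope_measurable pK.
  (* The difference is written as a signed sum over the booleans so that [vint_sum] applies. *)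
  transitivity (vint K (fun x => \sum_(b : bool) (-1) ^+ b / d * (if b then h x else g x))).
    apply: eq_vint => x; rewrite big_bool/= expr0 expr1 mulN1r mul1r.
    by rewrite mulrBl addrC mulNr ![d^-1 * _]mulrC.
  have ib (b : bool) : vintegrable K (if b then h else g).
    by case: b; exact: polyfun_vintegrable.
  rewrite (@vint_sum _ _ _ _ (fun (b : bool) x => (-1) ^+ b / d * (if b then h x else g x)))//.
    rewrite big_bool/= !vintZ//; [|exact: (ib false)|exact: (ib true)].
    by rewrite expr0 expr1 mulN1r mul1r mulrBl addrC mulNr ![d^-1 * _]mulrC.
  by case; apply: vintegrableZ => //; [exact: (ib true)|exact: (ib false)].
rewrite /kint -E//; try exact: vint_peval_polyfun.
by apply: eq_vint => x; rewrite E//; exact: peval_polyfun.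
Qed.

(** * Cancellation of the numerical fluxes *)

Lemma sum_bd_sum (O L : set vec) (M : mesh O L) (h : edge M -> bool -> R) :
  (forall e, h e false = - h e true) -> \sum_K bd_sum K h = 0.
Proof.
move=> hN; rewrite /bd_sum exchange_big big1// => e _.
transitivity (\sum_(b : bool) h e b); last by rewrite big_bool/= hN subrr.
(* Each side of an edge belongs to exactly one element, so both sides are counted once, even when
   the two elements coincide through periodicity. *)
by rewrite (partition_big (eelt e) predT).
Qed.

(** The outer dot product is odd in [n], while the jump coefficient contains [n] only inside an
    absolute value. The sign [sigma] is free, which covers central, upwind and downwind fluxes. *)
Lemma num_flux_opp sigma (w : vec) gp gm (np nm n : vec) :
  num_flux sigma w gp gm np nm (- n) = - num_flux sigma w gp gm np nm n.
Proof. by rewrite /num_flux !dotNr normrN. Qed.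

Lemma sintN (O L : set vec) (M : mesh O L) (e : edge M) g : sint e (fun x => - g x) = - sint e g.
Proof. exact: RintegralN_uncond. Qed.

Lemma eq_sint (O L : set vec) (M : mesh O L) (e : edge M) g h : g =1 h -> sint e g = sint e h.
Proof. by move=> gh; apply: eq_Rintegral => p _; exact: gh. Qed.

Definition pdf1 : pdf := fun _ _ => mpoly.mpolyC (3 + 3) 1.

Lemma peval_pdf1 Kx Kv x v : peval (pdf1 Kx Kv) x v = 1.
Proof. exact: mpoly.mevalC. Qed.

Lemma grad_pdf1 Kx Kv (u x v : vec) :
  dot u (grad_x (pdf1 Kx Kv) x v) = 0 /\ dot u (grad_v (pdf1 Kx Kv) x v) = 0.
Proof.
by split; rewrite (_ : _ (pdf1 Kx Kv) x v = 0) ?dot0r//;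
  apply/rowP => i; rewrite !mxE /peval mpoly.mderivC mpoly.meval0.
Qed.

Lemma A_K_pdf1 sigma (f : pdf) (E B : field) Kx Kv :
  A_K sigma f E B pdf1 Kx Kv =
  bd_sum Kx (fun e b =>
    vint (eset Kv) (fun v => sint e (fun x => flux_x sigma f e b Kv x v))) +
  bd_sum Kv (fun e b =>
    vint (eset Kx) (fun x => sint e (fun v => flux_v sigma f E B e b Kx x v))).
Proof.
rewrite /A_K kint0 => [|x v]; last by have [-> _] := grad_pdf1 Kx Kv v x v; rewrite mulr0.
rewrite kint0 => [|x v]; last first.
  by have [_ ->] := grad_pdf1 Kx Kv (lorentz E B Kx x v) x v; rewrite mulr0.
rewrite oppr0 !add0r.
apply: (f_equal2 +%R); apply: eq_bigr => e _; apply: eq_bigr => b _.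
  by apply: eq_vint => v; apply: eq_sint => x; rewrite peval_pdf1 mulr1.
by apply: eq_vint => x; apply: eq_sint => v; rewrite peval_pdf1 mulr1.
Qed.

Lemma sum_A_K_pdf1 sigma (f : pdf) (E B : field) :
  \sum_Kx \sum_Kv A_K sigma f E B pdf1 Kx Kv = 0.
Proof.
under eq_bigr do under eq_bigr do rewrite A_K_pdf1.
under eq_bigr do rewrite big_split.
(* Faces in [x] cancel in the sum over [Kx] for fixed [Kv], and faces in [v] in the sum over [Kv]
   for fixed [Kx]; the exchange makes the relevant sum the inner one. *)
rewrite big_split /= [X in X + _]exchange_big /= !big1 ?addr0// => K _;
  apply: sum_bd_sum => e; rewrite -vintN; apply: eq_vint => y;
  rewrite -sintN; apply: eq_sint => z; exact: num_flux_opp.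
Qed.

(** The transported function and the fields are arbitrary, so explicit stages and implicit averages
    are treated alike. *)
Lemma vlasov_eq_particle_number k vf (tau d : R) (f0 f1 f : pdf) (E B : field) :
  d != 0 -> vlasov_eq k vf tau d f0 f1 f E B ->
  particle_number f1 = particle_number f0.
Proof.
move=> d0 /(_ pdf1) H.
have {}H : forall Kx Kv, (kint Kx Kv (peval (f1 Kx Kv)) -
    kint Kx Kv (peval (f0 Kx Kv))) / d + A_K (jump_sign vf tau) f E B pdf1 Kx Kv = 0.
  move=> Kx Kv; rewrite -kint_scaled_diff -[RHS](H _ Kx Kv).
    apply: (f_equal2 +%R _ (erefl _)); apply: eq_kint => x v.
    by rewrite peval_pdf1 mulr1.
  (* The constant 1 has [msize] equal to 1, which is at most [k.+1] even for [k = 0]. *)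
  by move=> ? ?; rewrite mpoly.mmeasureC oner_eq0.
have : (\sum_Kx \sum_Kv (kint Kx Kv (peval (f1 Kx Kv)) -
    kint Kx Kv (peval (f0 Kx Kv)))) / d = 0.
  apply: etrans (_ : _ + \sum_Kx \sum_Kv A_K (jump_sign vf tau) f E B pdf1 Kx Kv = _).
    by rewrite sum_A_K_pdf1 addr0.
  rewrite mulr_suml -big_split big1//= => Kx _.
  by rewrite mulr_suml -big_split big1//= => Kv _; exact: H.
move/eqP; rewrite mulf_eq0 invr_eq0 (negbTE d0) orbF.
under eq_bigr do rewrite sumrB.
by rewrite sumrB subr_eq0 !particle_number_kint => /eqP.
Qed.

(** * The time integrators *)

Lemma beta2_lt0 : beta2 R < 0.
Proof.
rewrite /beta2 /beta1.
have h1 : 0 < 2 `^ 3^-1 :> R by rewrite powR_gt0.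
have h2 : 0 < 2 `^ (- 3^-1) :> R by rewrite powR_gt0.
(* Both powers are positive, so [beta1] exceeds 2/3 and [1 - 2 * beta1] is below -1/3. *)
lra.
Qed.

Lemma beta1_gt0 : 0 < beta1 R.
Proof. by rewrite divr_gt0// !addr_gt0// powR_gt0. Qed.

(** Each basic scheme contains one Vlasov equation leading directly from the old to the new density
    with increment [tau]. *)
Lemma scheme_step_base k r vf mf (tau : R) (s0 s1 : state mx mv) : tau != 0 ->
  [\/ scheme1 k r vf mf tau s0 s1, scheme2 k r vf mf tau s0 s1,
      scheme3 k r vf mf tau s0 s1 | scheme4 k r vf mf tau s0 s1] ->
  particle_number (sf s1) = particle_number (sf s0).
Proof.
move=> t0 [[fh [Bh [_ _ [_ _ _ _]]]]|[fh [_ [_ _ _]]]|[Eh [_ [_ _ + _]]]|[_ _]];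
  exact: vlasov_eq_particle_number.
Qed.

(** Conservation is assumed for every nonzero step size, not only for positive ones, because the
    middle substep runs backwards when [tau] is positive. *)
Lemma compose3_particle_number k r step (tau : R) (s0 s1 : state mx mv) :
  tau != 0 ->
  (forall t u w, t != 0 -> step t u w ->
    particle_number (sf w) = particle_number (sf u)) ->
  compose3 k r step tau s0 s1 ->
  particle_number (sf s1) = particle_number (sf s0).
Proof.
move=> t0 H [sa [sb [_ _ [h1 h2 h3]]]].
have b1 : beta1 R * tau != 0 by rewrite mulf_neq0// gt_eqF ?beta1_gt0.
have b2 : beta2 R * tau != 0 by rewrite mulf_neq0// lt_eqF ?beta2_lt0.
by rewrite (H _ _ _ b1 h3) (H _ _ _ b2 h2) (H _ _ _ b1 h1).
Qed.

End Conservation.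

Theorem theorem3p1 (R : realType) (a b : 'rV[R]_3) (Omega_v : set 'rV[R]_3)
    (mx : mesh (box a b) (periods a b)) (mv : mesh Omega_v [set 0])
    (k r : nat) (vf : vlasov_flux) (mf : maxwell_flux) (m : integrator)
    (dt : R) (s0 s1 : state mx mv) :
  (forall i, a 0 i < b 0 i) ->
  bounded_domain Omega_v ->
  0 < dt ->
  dg_step k r vf mf m dt s0 s1 ->
  particle_number (sf s1) = particle_number (sf s0).
Proof.
move=> _ _ dt0 [_ _]; have {}dt0 : dt != 0 by rewrite gt_eqF.
case: m => /= step.
- by apply: (scheme_step_base dt0); constructor 1; exact: step.
- by apply: (scheme_step_base dt0); constructor 2; exact: step.
- by apply: (scheme_step_base dt0); constructor 3; exact: step.
- by apply: (scheme_step_base dt0); constructor 4; exact: step.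
- apply: (compose3_particle_number dt0 _ step) => t u w t0 h.
  by apply: (scheme_step_base t0); constructor 3; exact: h.
- apply: (compose3_particle_number dt0 _ step) => t u w t0 h.
  by apply: (scheme_step_base t0); constructor 4; exact: h.
Qed.
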